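(* Let $n_1,\ldots,n_t$ be positive integers, and let $t_e$ and $t_o$ be respectively the number of even and odd integers in the sequence $(n_1,\ldots,n_t)$. Let $m$ be a positive integer and $N=82\times35^{2^{t_o}-2}\times 81^{t_e}m$, and suppose that $m\geq n_i\geq 2(\lceil \log N \rceil+1)$ for each $1\leq i\leq t$. Then $$R(C_{n_1},\ldots,C_{n_t},K_{m,m})\leq N.$$
   Context: $C_k$ denotes the cycle on $k$ vertices and $K_{m,m}$ the complete bipartite graph with both parts of size $m$. For graphs $G_1,\ldots,G_k$, the Ramsey number $R(G_1,\ldots,G_k)$ is the smallest integer $N$ such that for every coloring of the edges of the complete graph $K_N$ with colors $1,\ldots,k$ there is, for some $i$, a copy of $G_i$ all of whose edges have color $i$. $\log$ denotes the logarithm to base $2$. *)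

(* Defs.v *)
From HB Require Import structures.
From mathcomp Require Import all_boot all_order all_algebra.
From mathcomp Require Import all_classical all_reals all_analysis.
Set Implicit Arguments. Unset Strict Implicit. Unset Printing Implicit Defensive.
Import Order.TTheory GRing.Theory Num.Theory.

(* An edge colouring of K_N (vertex set 'I_N) with t+1 colours:
   colour [Some i] (i < t) is the colour for the cycle C_{n_i},
   colour [None] is the colour for K_{m,m}.  Only values on pairs of
   distinct vertices matter; the colouring must be symmetric. *)
Definition coloring (t N : nat) := 'I_N -> 'I_N -> option 'I_t.

Definition symmetric_coloring t N (c : coloring t N) : Prop :=
  forall x y : 'I_N, c x y = c y x.

Definition has_mono_cycle t N (c : coloring t N) (k : nat) (col : option 'I_t) : Prop :=
  exists f : 'I_k -> 'I_N, injective f /\ forall j : 'I_k, c (f j) (f (ordS j)) = col.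

Definition has_mono_Kmm t N (c : coloring t N) (m : nat) (col : option 'I_t) : Prop :=
  exists (f g : 'I_m -> 'I_N), injective f /\ injective g /\
    (forall a b, f a <> g b) /\ (forall a b, c (f a) (g b) = col).

Definition ramsey_prop t (n : 'I_t -> nat) (m N : nat) : Prop :=
  forall c : coloring t N, symmetric_coloring c ->
    (exists i : 'I_t, has_mono_cycle c (n i) (Some i)) \/ has_mono_Kmm c m None.

(* R(C_{n_1},...,C_{n_t},K_{m,m}) <= x  (x real): the least N with the
   arrow property exists and is at most x, i.e. some N' <= x has it. *)
Definition ramsey_le t (n : 'I_t -> nat) (m : nat) {R : realType} (x : R) : Prop :=
  exists N' : nat, (N'%:R <= x)%R /\ ramsey_prop n m N'.

Definition t_even t (n : 'I_t -> nat) : nat := #|[set i | ~~ odd (n i)]|.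
Definition t_odd t (n : 'I_t -> nat) : nat := #|[set i | odd (n i)]|.

Definition log2 {R : realType} (x : R) : R := (ln x / ln 2)%R.

(* N = 82 * 35^(2^{t_o} - 2) * 81^{t_e} * m  (integer exponent, so the
   case t_o = 0 gives the factor 35^{-1}, as in the paper's formula). *)
Definition boundN (R : realType) t (n : 'I_t -> nat) (m : nat) : R :=
  (82 * (35 : R) ^ ((2 ^ t_odd n)%N%:Z - 2)%R * 81 ^+ t_even n * m%:R)%R.

(* Main.v *)
(* Call two vertex sets s-joined in a graph if any two of their subsets of size
   s span an edge.  The basic tool is that two joined sets of size 30 s contain
   every even cycle, and three pairwise joined sets of size 20 s every odd
   cycle, whose length lies between about 2 log s and s: depth-first search
   gives a path of length 6 s, and deleting non-expanding sets leaves two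
   reservoirs in which binary branching of a fixed depth reaches s vertices, so
   that two path vertices at the right distance can be linked through the
   reservoirs by one last edge.

   Hence, if no cycle of the wanted length exists in one colour, there are
   smaller sets between which this colour is absent.  For even lengths this
   removes one colour after the other from between two sets.  For odd lengths,
   removing the other colours first between two sets A, B and then between two
   subsets of A gives three sets between which only the remaining odd colour is
   left; this squares the loss factor with each odd colour and explains the
   exponent 2^t_o.  After all colours are removed, the two remaining sets of
   size m span the K_{m,m}. *)
From mathcomp Require Import all_boot zify.
Set Implicit Arguments. Unset Strict Implicit. Unset Printing Implicit Defensive.

(** * Neighbourhoods, gaps and joined sets *)

Definition nbr (T : finType) (e : rel T) (A B : {set T}) : {set T} :=
  [set y in B | [exists x in A, e x y]].

Definition gap (T : finType) (e : rel T) (A B : {set T}) : bool :=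
  [forall x in A, forall y in B, ~~ e x y].

Definition joined (T : finType) (e : rel T) (s : nat) (A B : {set T}) : bool :=
  [forall A' : {set T}, forall B' : {set T},
     [&& A' \subset A, B' \subset B, s <= #|A'| & s <= #|B'|] ==> ~~ gap e A' B'].

Lemma gapP (T : finType) (e : rel T) (A B : {set T}) :
  reflect {in A & B, forall x y, ~~ e x y} (gap e A B).
Proof.
apply: (iffP 'forall_implyP) => [h x y xA yB|h x xA].
  by have /forallP/(_ y)/implyP -> := h x xA.
by apply/forallP => y; apply/implyP => yB; apply: h.
Qed.

Lemma gap_sub (T : finType) (e : rel T) (A B A' B' : {set T}) :
  A' \subset A -> B' \subset B -> gap e A B -> gap e A' B'.
Proof.
move=> /subsetP sA /subsetP sB /gapP h; apply/gapP => x y xA yB.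
by apply: h; [apply: sA | apply: sB].
Qed.

Lemma gapC (T : finType) (e : rel T) (A B : {set T}) :
  symmetric e -> gap e A B = gap e B A.
Proof.
by move=> se; apply/gapP/gapP => h x y xA yB; rewrite se; apply: h.
Qed.

Lemma joinedP (T : finType) (e : rel T) (s : nat) (A B A' B' : {set T}) :
  joined e s A B -> A' \subset A -> B' \subset B -> s <= #|A'| -> s <= #|B'| ->
  exists x y, [/\ x \in A', y \in B' & e x y].
Proof.
move=> /forallP/(_ A')/forallP/(_ B')/implyP h sA sB cA cB.
have /h : [&& A' \subset A, B' \subset B, s <= #|A'| & s <= #|B'|].
  by rewrite sA sB cA cB.
rewrite negb_forall => /existsP[x]; rewrite negb_imply => /andP[xA].
rewrite negb_forall => /existsP[y]; rewrite negb_imply negbK => /andP[yB exy].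
by exists x, y.
Qed.

Lemma joined_sub (T : finType) (e : rel T) (s : nat) (A B A' B' : {set T}) :
  A' \subset A -> B' \subset B -> joined e s A B -> joined e s A' B'.
Proof.
move=> sA sB /forallP h; apply/forallP => A2; apply/forallP => B2.
apply/implyP => /and4P[sA2 sB2 cA cB].
move/forallP/(_ B2)/implyP: (h A2); apply.
by rewrite cA cB (subset_trans sA2) // (subset_trans sB2).
Qed.

Lemma joinedC (T : finType) (e : rel T) (s : nat) (A B : {set T}) :
  symmetric e -> joined e s A B -> joined e s B A.
Proof.
move=> se /forallP h; apply/forallP => B2; apply/forallP => A2.
apply/implyP => /and4P[sB sA cB cA]; rewrite gapC //.
by move/forallP/(_ B2)/implyP: (h A2); apply; rewrite sA sB cA cB.
Qed.

Lemma subset_of_card (T : finType) (A : {set T}) (k : nat) :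
  k <= #|A| -> exists B : {set T}, B \subset A /\ #|B| = k.
Proof.
move=> /card_geqP[l [ul <- sl]]; exists [set x in l]; split.
  by apply/subsetP => x; rewrite inE; apply: sl.
by rewrite cardsE; apply/card_uniqP.
Qed.

Lemma not_joined (T : finType) (e : rel T) (s : nat) (A B : {set T}) :
  ~~ joined e s A B ->
  exists A' B' : {set T},
    [/\ A' \subset A, B' \subset B, #|A'| = s, #|B'| = s & gap e A' B'].
Proof.
rewrite negb_forall => /existsP[A1]; rewrite negb_forall => /existsP[B1].
rewrite negb_imply negbK => /andP[/and4P[sA sB cA cB] g].
have [A2 [sA2 cA2]] := subset_of_card cA.
have [B2 [sB2 cB2]] := subset_of_card cB.
exists A2, B2; split=> //; [exact: subset_trans sA2 sA | exact: subset_trans sB2 sB |].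
exact: gap_sub sA2 sB2 g.
Qed.

Lemma in_nbr (T : finType) (e : rel T) (A B : {set T}) y :
  y \in nbr e A B -> y \in B /\ exists2 x, x \in A & e x y.
Proof. by rewrite inE => /andP[yB /existsP[x /andP[xA exy]]]; split=> //; exists x. Qed.

Lemma nbrU (T : finType) (e : rel T) (A A' B : {set T}) :
  nbr e (A :|: A') B = nbr e A B :|: nbr e A' B.
Proof.
apply/setP => y; rewrite !inE -andb_orr; congr (_ && _).
apply/existsP/orP => [[x /andP[]]|].
  by rewrite inE => /orP[] xA exy; [left | right]; apply/existsP; exists x; rewrite xA.
by case=> /existsP[x /andP[xA exy]]; exists x; rewrite inE xA ?orbT.
Qed.

Lemma nbr_sub (T : finType) (e : rel T) (A B B' : {set T}) :
  B \subset B' -> nbr e A B \subset nbr e A B'.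
Proof.
move=> /subsetP sB; apply/subsetP => y; rewrite !inE => /andP[/sB -> ->//].
Qed.

(** Otherwise [A'] and the part of [B] it misses would be two large sets without an edge. *)
Lemma joined_nbr (T : finType) (e : rel T) (s : nat) (A B A' : {set T}) :
  joined e s A B -> A' \subset A -> s <= #|A'| -> #|B :\: nbr e A' B| < s.
Proof.
move=> j sA cA; rewrite ltnNge; apply/negP => cB.
have [x [y [xA]]] := joinedP j sA (subsetDl B (nbr e A' B)) cA cB.
rewrite !inE => /andP[+ yB] exy; rewrite yB /= => /negP; apply.
by apply/existsP; exists x; rewrite xA.
Qed.

(** * Expansion and branching *)

(* Both sides are cleaned at once: a maximal pair of disposable sets [P], [Q]
   whose remaining neighbourhoods are small stays below size [s], because a
   set of size between [s] and [2 s] has almost the whole other side as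
   neighbourhood. *)
Lemma expanding_core (T : finType) (e : rel T) (s : nat) (X Y : {set T}) :
  symmetric e -> joined e s X Y -> 10 * s <= #|X| -> 10 * s <= #|Y| ->
  exists X' Y' : {set T},
    [/\ X' \subset X, Y' \subset Y, 9 * s <= #|X'|,
        forall S : {set T}, S \subset X' -> #|S| < s -> 4 * #|S| <= #|nbr e S Y'|
      & forall S : {set T}, S \subset Y' -> #|S| < s -> 4 * #|S| <= #|nbr e S X'|].
Proof.
move=> se jXY cX cY.
have jYX := joinedC se jXY.
case: (posnP s) => [s0|s_gt0].
  by exists set0, set0; split; rewrite ?sub0set ?s0.
pose ok (PQ : {set T} * {set T}) :=
  [&& PQ.1 \subset X, PQ.2 \subset Y, #|PQ.1| < s, #|PQ.2| < s,
   #|nbr e PQ.1 (Y :\: PQ.2)| <= 4 * #|PQ.1| & #|nbr e PQ.2 (X :\: PQ.1)| <= 4 * #|PQ.2|].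
have nbr0 B : nbr e set0 B = set0.
  apply/setP => y; rewrite !inE; apply/negP => /andP[_ /existsP[x]].
  by rewrite inE.
have ok0 : ok (set0, set0) by rewrite /ok /= !sub0set !nbr0 !cards0 s_gt0.
case: (arg_maxnP (fun PQ : {set T} * {set T} => #|PQ.1| + #|PQ.2|) ok0).
move=> [P Q] /and5P[/= sP sQ cP cQ /andP[nP nQ]] Pmax.
have half (X0 Y0 P0 Q0 S : {set T}) : joined e s X0 Y0 -> 10 * s <= #|Y0| ->
    P0 \subset X0 -> #|P0| < s -> #|Q0| < s -> S \subset X0 :\: P0 -> #|S| < s ->
    #|nbr e P0 (Y0 :\: Q0)| <= 4 * #|P0| ->
    #|nbr e S (Y0 :\: Q0)| < 4 * #|S| ->
    [/\ P0 :|: S \subset X0, #|P0 :|: S| = #|P0| + #|S|, #|P0 :|: S| < s,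
        0 < #|S| & #|nbr e (P0 :|: S) (Y0 :\: Q0)| <= 4 * #|P0 :|: S|].
  move=> j cY0 sP0 cP0 cQ0 sS cS nP0 nS.
  have sPS : P0 :|: S \subset X0.
    by rewrite subUset sP0 (subset_trans sS) // subsetDl.
  have cPS : #|P0 :|: S| = #|P0| + #|S|.
    rewrite cardsU; suff -> : P0 :&: S = set0 by rewrite cards0 subn0.
    apply/setP => x; rewrite !inE; apply/negP => /andP[xP /(subsetP sS)].
    by rewrite inE xP.
  have nPS : #|nbr e (P0 :|: S) (Y0 :\: Q0)| <= 4 * #|P0 :|: S|.
    rewrite cPS nbrU (leq_trans (leq_card_setU _ _)) //; lia.
  split=> //; [|lia].
  (* The union has fewer than [2 * s] elements, hence fewer than [8 * s] neighbours outside [Q0]. If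
     it had at least [s] elements, it would miss fewer than [s] vertices of [Y0]; with [#|Q0| < s]
     this gives [#|Y0| < 10 * s]. *)
  rewrite ltnNge; apply/negP => cge.
  have := joined_nbr j sPS cge.
  have : #|Y0| <= #|Y0 :\: nbr e (P0 :|: S) Y0| + #|nbr e (P0 :|: S) (Y0 :\: Q0)| + #|Q0|.
    apply: leq_trans (leq_trans (leq_card_setU _ _) (leq_add (leq_card_setU _ _) (leqnn _))).
    apply: subset_leq_card; apply/subsetP => y yY; rewrite !inE yY.
    by case: (y \in Q0); rewrite ?orbT //= andbT orbF orNb.
  lia.
exists (X :\: P), (Y :\: Q); split; rewrite ?subsetDl //.
- by rewrite cardsD (setIidPr sP); lia.
- move=> S sS cS; rewrite leqNgt; apply/negP => nS.
  have [h1 h2 h3 h4 h5] := half X Y P Q S jXY cY sP cP cQ sS cS nP nS.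
  have /Pmax /= : ok (P :|: S, Q).
    rewrite /ok /= h1 sQ h3 cQ h5 /= (leq_trans _ nQ) //.
    by apply: subset_leq_card; apply: nbr_sub; rewrite setDS // subsetUl.
  lia.
- move=> S sS cS; rewrite leqNgt; apply/negP => nS.
  have [h1 h2 h3 h4 h5] := half Y X Q P S jYX cX sQ cQ cP sS cS nQ nS.
  have /Pmax /= : ok (P, Q :|: S).
    rewrite /ok /= h1 sP h3 cP h5 /= andbT (leq_trans _ nP) //.
    by apply: subset_leq_card; apply: nbr_sub; rewrite setDS // subsetUl.
  lia.
Qed.

(** A layer of [2 ^ j] vertices still to be extended is smaller than [s], so it has at least
    [4 * 2 ^ j] neighbours on the other side. Fewer than [2 ^ j.+1] vertices are used already, which
    leaves enough new ones to double the layer. *)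
Lemma path_tree (T : finType) (e : rel T) (s : nat) (X Y : {set T}) (u : T) (j : nat) :
  (forall S : {set T}, S \subset X -> #|S| < s -> 4 * #|S| <= #|nbr e S Y|) ->
  (forall S : {set T}, S \subset Y -> #|S| < s -> 4 * #|S| <= #|nbr e S X|) ->
  u \in X -> 2 ^ j < 2 * s ->
  exists U L : {set T},
    [/\ U \subset X :|: Y, L \subset (if odd j then Y else X), #|L| = 2 ^ j,
        #|U| < 2 ^ j.+1
      & forall x, x \in L -> exists p : seq T, [/\ path e u p, last u p = x, size p = j,
          uniq (u :: p) & {subset u :: p <= U}]].
Proof.
move=> expX expY uX; elim: j => [|j IHj] hj.
  exists [set u], [set u]; split; rewrite ?cards1 ?sub1set ?inE ?uX //=.
  by move=> x /set1P ->; exists [::]; split=> // y; rewrite !inE.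
have [|U [L [sU sL cL cU hL]]] := IHj; first by move: hj; rewrite expnS; move: (2 ^ j) => w; lia.
rewrite expnS ltn_pmul2l // in hj.
set Z := if odd j.+1 then Y else X.
have cN : 4 * #|L| <= #|nbr e L Z|.
  by rewrite /Z /=; case: (odd j) sL => /= sL; [apply: expY | apply: expX] => //; rewrite cL.
have [|M [sM cM]] := @subset_of_card _ (nbr e L Z :\: U) (2 ^ j.+1).
  have := cardsID U (nbr e L Z).
  have : #|nbr e L Z :&: U| <= #|U| by apply: subset_leq_card; rewrite subsetIr.
  by move: cL cU cN; rewrite !expnS; move: (2 ^ j) => w; lia.
have sMZ : M \subset Z.
  by apply/subsetP => x /(subsetP sM); rewrite inE => /andP[_ /in_nbr[]].
exists (U :|: M), M; split=> //.
- rewrite subUset sU (subset_trans sMZ) // /Z.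
  by case: ifP => _; rewrite ?subsetUl ?subsetUr.
- have : #|U :|: M| <= #|U| + #|M| by rewrite leq_card_setU.
   move: cM cU; rewrite !expnS; move: (2 ^ j) => w; lia.
move=> y yM; have /setDP[/in_nbr[_ [x xL exy]] yU] := subsetP sM y yM.
have [p [pp lp sp up subp]] := hL x xL.
exists (rcons p y); split.
- by rewrite rcons_path pp lp.
- by rewrite last_rcons.
- by rewrite size_rcons sp.
- rewrite -rcons_cons rcons_uniq up andbT.
  by apply: contra yU => /subp.
- move=> z; rewrite -rcons_cons mem_rcons inE => /predU1P[-> | /subp zU].
    by rewrite inE yM orbT.
  by rewrite inE zU.
Qed.

(** * Long paths by depth-first search *)

(* Depth-first search: [D] is the set of finished vertices, [U] the set of
   unvisited ones and [p] the stack.  Every step raises [2 * #|D| + size p]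
   by one, so the search passes through a state with [#|D| = #|U|]. *)
Lemma dfs_state (T : finType) (r : rel T) (Z : {set T}) (j : nat) :
  symmetric r -> j <= 2 * #|Z| ->
  exists (D U : {set T}) (p : seq T),
    [/\ uniq p, sorted r p, gap r D U, 2 * #|D| + size p = j &
     [/\ #|D| + #|U| + size p = #|Z|, D \subset Z, U \subset Z, {subset p <= Z}
       & forall z, z \in Z -> [|| z \in D, z \in U | z \in p]]].
Proof.
move=> sr; elim: j => [|j IHj] hj.
  exists set0, Z, [::]; split; rewrite ?cards0 //.
    by apply/gapP => x y; rewrite inE.
  by split; rewrite ?sub0set ?add0n ?addn0 // => z ->; rewrite orbT.
have [|D [U [p [up sp gDU cj [cZ sD sU sP cov]]]]] := IHj; first lia.
have addU y : y \in U -> sorted r (y :: p) ->  exists (D' U' : {set T}) (p' : seq T),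
    [/\ uniq p', sorted r p', gap r D' U', 2 * #|D'| + size p' = j.+1 &
     [/\ #|D'| + #|U'| + size p' = #|Z|, D' \subset Z, U' \subset Z, {subset p' <= Z}
       & forall z, z \in Z -> [|| z \in D', z \in U' | z \in p']]].
  move=> yU syp.
  (* [D], [U] and the stack cover [Z] and their sizes add up to [#|Z|], so they cannot overlap. *)
  have yp : y \notin p.
    apply/negP => yp.
    have : #|Z| <= #|D| + #|U| + size (rem y p).
      have sub : Z \subset D :|: U :|: [set x in rem y p].
        apply/subsetP => z zZ; rewrite !inE mem_rem_uniq // inE.
        case: eqVneq => [->|_]; first by rewrite yU orbT.
        by rewrite -orbA; apply: cov.
      apply: leq_trans (subset_leq_card sub) _.
      apply: leq_trans (leq_add (leq_card_setU _ _) (card_size _)) => //.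
      by rewrite (leq_trans (leq_card_setU _ _)) // leq_add2l cardsE.
    by rewrite -cZ (size_rem yp); case: (p) yp => //= a l _; lia.
  exists D, (U :\ y), (y :: p); split=> //=.
  - by rewrite yp.
  - exact: gap_sub (subxx _) (subD1set _ _) gDU.
  - lia.
  split=> //.
  - by have := cardsD1 y U; rewrite yU; lia.
  - by rewrite (subset_trans (subD1set _ _)).
  - by move=> z; rewrite inE => /predU1P[->|/sP //]; apply: (subsetP sU).
  - by move=> z /cov; rewrite !inE; case: (z == y) => /=; rewrite ?orbT.
case: p => [|x p] in up sp cj cZ sP cov addU *.
  have [U0|[y yU]] := set_0Vmem U; last exact: (addU y).
  by move: cZ cj hj; rewrite U0 cards0 /=; lia.
have [/existsP[y /andP[yU rxy]]|nox] := boolP [exists y in U, r x y].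
  by apply: (addU y) => //=; rewrite sr rxy.
have xD : x \notin D.
  apply/negP => xD.
  have : #|Z| <= #|D| + #|U| + size p.
    have sub : Z \subset D :|: U :|: [set z in p].
      apply/subsetP => z /cov; rewrite !inE.
      by case: eqVneq => [->|_]; rewrite ?xD // orbA.
    apply: leq_trans (subset_leq_card sub) _.
    rewrite (leq_trans (leq_card_setU _ _)) //.
    by rewrite leq_add ?leq_card_setU // cardsE card_size.
  by move: cZ => /=; lia.
exists (x |: D), U, p; split.
- by case/andP: up.
- exact: path_sorted sp.
- apply/gapP => a b /setU1P[->|aD] bU; last exact: (gapP _ _ _ gDU).
  by apply: contra nox => rxb; apply/existsP; exists b; rewrite bU.
- by rewrite cardsU1 xD; move: cj => /=; lia.
split=> //.
- by rewrite cardsU1 xD; move: cZ => /=; lia.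
- by rewrite subUset sub1set sD sP ?mem_head.
- by move=> z zp; apply: sP; rewrite inE zp orbT.
- move=> z /cov; rewrite !inE.
  by case: (z == x) => /=; rewrite ?orbT.
Qed.

Definition crossing (T : finType) (e : rel T) (A B : {set T}) : rel T :=
  fun x y => e x y && ((x \in A) && (y \in B) || (x \in B) && (y \in A)).

Lemma crossing_sym (T : finType) (e : rel T) (A B : {set T}) :
  symmetric e -> symmetric (crossing e A B).
Proof.
move=> se x y; rewrite /crossing se orbC; congr (_ && _).
by rewrite [(x \in B) && _]andbC [(x \in A) && _]andbC.
Qed.

(** The search is stopped when [#|D| = #|U|]. With a stack below [6 * s], [D] and [U] have over
    [7 * s] vertices each, and together over [4 * s] in each of [A] and [B]. But the gap makes one
    of [D :&: A], [U :&: B] and one of [U :&: A], [D :&: B] smaller than [s]. *)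
Lemma long_crossing_path (T : finType) (e : rel T) (s : nat) (A B : {set T}) :
  symmetric e -> joined e s A B -> [disjoint A & B] ->
  10 * s <= #|A| -> 10 * s <= #|B| -> 0 < s ->
  exists p : seq T, [/\ uniq p, sorted (crossing e A B) p, 6 * s <= size p
              & {subset p <= A :|: B}].
Proof.
move=> se j dAB cA cB s_gt0.
have cAB : #|A :|: B| = #|A| + #|B|.
  by rewrite cardsU (disjoint_setI0 dAB) cards0 subn0.
have [|D [U [p [up sp gDU cj [cZ sD sU sP cov]]]]] :=
  @dfs_state T _ (A :|: B) #|A :|: B| (crossing_sym A B se); first by lia.
exists p; split=> //; rewrite leqNgt; apply/negP => short.
have cDU (C : {set T}) : C \subset A :|: B -> #|C| <= #|D :&: C| + #|U :&: C| + size p.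
  move=> sC; have sub : C \subset (D :&: C) :|: (U :&: C) :|: [set z in p].
    apply/subsetP => z zC; have := cov z (subsetP sC z zC).
    by rewrite !inE zC !andbT orbA.
  apply: leq_trans (subset_leq_card sub) _.
  rewrite (leq_trans (leq_card_setU _ _)) //.
  by rewrite leq_add ?leq_card_setU // cardsE card_size.
have split2 (C : {set T}) : C \subset A :|: B -> #|C| <= #|C :&: A| + #|C :&: B|.
  move=> sC; rewrite -{1}(setIidPl sC) setIUr.
  by rewrite leq_card_setU.
have hA := cDU A (subsetUl _ _); have hB := cDU B (subsetUr _ _).
have hD := split2 D sD; have hU := split2 U sU.
have c1 : (#|D :&: A| < s) || (#|U :&: B| < s).
  have [//|c1] := ltnP #|D :&: A| s; rewrite /= ltnNge; apply/negP => c2.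
  have [x [y [/setIP[xD xA] /setIP[yU yB] exy]]] :=
    joinedP j (subsetIr _ _) (subsetIr _ _) c1 c2.
  by have /negP[] := gapP _ _ _ gDU x y xD yU; rewrite /crossing exy xA yB.
have c2 : (#|U :&: A| < s) || (#|D :&: B| < s).
  have [//|c3] := ltnP #|U :&: A| s; rewrite /= ltnNge; apply/negP => c4.
  have [x [y [/setIP[xU xA] /setIP[yD yB] exy]]] :=
    joinedP j (subsetIr _ _) (subsetIr _ _) c3 c4.
  have /negP[] := gapP _ _ _ gDU y x yD xU.
  by rewrite /crossing se exy xA yB orbT.
lia.
Qed.

Lemma crossing_nth (T : finType) (e : rel T) (A B : {set T}) (x0 : T) (p : seq T) i k :
  [disjoint A & B] -> sorted (crossing e A B) p -> i + k < size p ->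
  nth x0 p i \in A -> nth x0 p (i + k) \in (if odd k then B else A).
Proof.
move=> dAB /(sortedP x0) sp; elim: k => [|k IHk] hk iA; first by rewrite addn0.
have {IHk} /= := IHk _ iA; rewrite addnS in hk *.
move=> /(_ (ltnW hk)); have /andP[_] := sp _ hk.
have disj z : z \in A -> z \in B = false by move=> zA; apply: (disjointFr dAB).
case: (odd k) => /= /orP[] /andP[h1 h2] h3 //.
- by rewrite (disj _ h1) in h3.
- by rewrite (disj _ h3) in h1.
Qed.

(** * Closing a path into a cycle *)

(** The exceptional vertices are those without a neighbour in the expanding core of [X]. From such a
    neighbour, branching to depth [up_log 2 s] reaches at least [s] ends, all at the same distance,
    which makes the cycle length exact. *)
Lemma reservoir (T : finType) (e : rel T) (s : nat) (X Y Z : {set T}) :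
  symmetric e -> joined e s X Y -> joined e s Z X ->
  10 * s <= #|X| -> 10 * s <= #|Y| -> 0 < s ->
  exists bad : {set T}, #|bad| < s /\
    forall v, v \in Z -> v \notin bad ->
    exists L : {set T}, [/\ L \subset (if odd (up_log 2 s) then Y else X), s <= #|L|
      & forall x, x \in L -> exists p : seq T, [/\ path e v p, last v p = x,
          size p = (up_log 2 s).+1, uniq p & {subset p <= X :|: Y}]].
Proof.
move=> se jXY jZX cX cY s_gt0.
have [X' [Y' [sX sY cX' expX expY]]] := expanding_core se jXY cX cY.
exists (Z :\: nbr e X' Z); split.
  by apply: joined_nbr (joinedC se jZX) sX _; lia.
move=> v vZ; rewrite inE vZ andbT negbK => /in_nbr[_ [u uX euv]].
have hs : 2 ^ up_log 2 s < 2 * s.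
  case: (ltnP 1 s) => [s1|]; last by case: (s) s_gt0 => [|[|]].
  have /andP[h _] := up_log_bounds (ltnSn 1) s1.
  have d_gt0 : 0 < up_log 2 s by rewrite up_log_gt0.
  by rewrite -(prednK d_gt0) expnS ltn_pmul2l.
have [U [L [sU sL cL cU hL]]] := path_tree expX expY uX hs.
exists L; split.
- by apply: subset_trans sL _; case: ifP.
- by rewrite cL up_logP.
move=> x /hL[p [pp lp sp up subp]]; exists (u :: p); split=> //=.
- by rewrite se euv.
- by rewrite sp.
- by move=> z /subp /(subsetP sU); apply: (subsetP (setUSS sX sY)).
Qed.

(** By injectivity each entry of [bad1] or [bad2] excludes at most one index. *)
Lemma good_index (T : eqType) (k : nat) (f g : nat -> T)
    (bad1 bad2 : seq T) :
  (forall i j, i < k -> j < k -> f i = f j -> i = j) ->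
  (forall i j, i < k -> j < k -> g i = g j -> i = j) ->
  size bad1 + size bad2 < k ->
  exists i, [/\ i < k, f i \notin bad1 & g i \notin bad2].
Proof.
move=> injf injg hk.
have cnt (h : nat -> T) bad : (forall i j, i < k -> j < k -> h i = h j -> i = j) ->
    size [seq i <- iota 0 k | h i \in bad] <= size bad.
  move=> injh; rewrite -(size_map h); apply: uniq_leq_size.
    rewrite map_inj_in_uniq ?filter_uniq ?iota_uniq // => i j.
    by rewrite !mem_filter !mem_iota => /and3P[_ _ hi] /and3P[_ _ hj]; apply: injh.
  by move=> y /mapP[i]; rewrite mem_filter => /andP[hi _] ->.
have : has (fun i => (f i \notin bad1) && (g i \notin bad2)) (iota 0 k).
  apply/negPn/negP => /hasPn no.
  have /(uniq_leq_size (iota_uniq 0 k)) :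
      {subset iota 0 k <= [seq i <- iota 0 k | f i \in bad1] ++
                          [seq i <- iota 0 k | g i \in bad2]}.
    move=> i ik; rewrite mem_cat !mem_filter ik !andbT.
    by have := no i ik; rewrite negb_and !negbK.
  rewrite size_cat size_iota leqNgt => /negP; apply.
  exact: leq_ltn_trans (leq_add (cnt f bad1 injf) (cnt g bad2 injg)) hk.
by case/hasP => i; rewrite mem_iota => ik /andP[h1 h2]; exists i.
Qed.

(* The cycle consists of a stretch of [l] edges of a long path alternating
   between [Z0] and [Z1], one branch in each of the two reservoirs, and an
   edge between the ends of the branches. *)
Lemma joined_cycle (T : finType) (e : rel T) (s n l : nat)
    (Z0 Z1 X1 Y1 X2 Y2 : {set T}) :
  symmetric e -> 0 < s -> l <= s -> n = l + 2 * up_log 2 s + 3 ->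
  joined e s Z0 Z1 -> joined e s X1 Y1 -> joined e s X2 Y2 ->
  joined e s Z0 X1 -> joined e s (if odd l then Z1 else Z0) X2 ->
  joined e s X1 X2 -> joined e s Y1 Y2 ->
  10 * s <= #|Z0| -> 10 * s <= #|Z1| -> 10 * s <= #|X1| -> 10 * s <= #|Y1| ->
  10 * s <= #|X2| -> 10 * s <= #|Y2| ->
  [disjoint Z0 & Z1] -> [disjoint Z0 :|: Z1 & X1 :|: Y1] ->
  [disjoint Z0 :|: Z1 & X2 :|: Y2] -> [disjoint X1 :|: Y1 & X2 :|: Y2] ->
  exists p : seq T, [/\ size p = n, uniq p & cycle e p].
Proof.
move=> se s_gt0 ls nE jZ j1 j2 jZ1 jZ2 jX jY cZ0 cZ1 cX1 cY1 cX2 cY2 dZ dZ1 dZ2 d12.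
have [p [up sp hp subp]] := long_crossing_path se jZ dZ cZ0 cZ1 s_gt0.
have [bad1 [cb1 good1]] := reservoir se j1 jZ1 cX1 cY1 s_gt0.
have [bad2 [cb2 good2]] := reservoir se j2 jZ2 cX2 cY2 s_gt0.
have [x0 _] : exists x, x \in X1 by apply/card_gt0P; rewrite (leq_trans _ cX1) // muln_gt0.
(* The path alternates, so one of its first two vertices lies in [Z0]. *)
have [i0 i01 i0Z] : exists2 i0, i0 <= 1 & nth x0 p i0 \in Z0.
  have h0 : 0 < size p by clear - s_gt0 hp; lia.
  have := subp _ (mem_nth x0 h0); rewrite inE => /orP[|h]; first by exists 0.
  exists 1 => //; have h1 : 1 < size p by clear - s_gt0 hp; lia.
  have /andP[_] := (sortedP x0 sp) 0 h1.
  by rewrite (disjointFl dZ h) h.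
have nthI a b : nth x0 p a = nth x0 p b -> a < size p -> b < size p -> a = b.
  by move=> /eqP + ha hb; rewrite nth_uniq // => /eqP.
(* Steps of two stay in [Z0]. Fewer than [2 * s] of the [2 * s] candidates are excluded, and the far
   end has position at most [1 + 2 * (2 * s - 1) + s < 6 * s]. *)
have [i [ik fi gi]] : exists i, [/\ i < 2 * s, nth x0 p (i0 + 2 * i) \notin enum bad1
    & nth x0 p (i0 + 2 * i + l) \notin enum bad2].
  apply: (@good_index _ _ (fun i => nth x0 p (i0 + 2 * i))
            (fun i => nth x0 p (i0 + 2 * i + l))).
  - by move=> i j hi hj /nthI; clear - hi hj hp ls i01; lia.
  - by move=> i j hi hj /nthI; clear - hi hj hp ls i01; lia.
  - by rewrite -!cardE; clear - cb1 cb2; lia.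
rewrite !mem_enum in fi gi.
set a := i0 + 2 * i in fi gi; have al : a + l < size p by rewrite /a; clear - ik hp ls i01; lia.
have aZ : nth x0 p a \in Z0.
  have := @crossing_nth _ _ _ _ x0 p i0 (2 * i) dZ sp.
  by rewrite oddM /=; apply => //; rewrite /a in al; clear - al; lia.
have [L1 [sL1 cL1 hL1]] := good1 _ aZ fi.
have [L2 [sL2 cL2 hL2]] := good2 _ (crossing_nth dZ sp al aZ) gi.
(* Both branches have the same depth; its parity decides whether their ends lie in [Y1] and [Y2] or
   in [X1] and [X2]. *)
have [x1 [x2 [/hL1[p1 [pp1 lp1 sp1 up1 sub1]] /hL2[p2 [pp2 lp2 sp2 up2 sub2]] e12]]] :
    exists x y, [/\ x \in L1, y \in L2 & e x y].
  by move: sL1 sL2; case: ifP => _ sL1 sL2; [apply: joinedP jY _ _ _ _ | apply: joinedP jX _ _ _ _].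
have := drop_nth x0 (leq_ltn_trans (leq_addr l a) al).
set v := nth x0 p a in pp1 lp1 *; set q := drop a.+1 p => dropE.
have sq : l <= size q by rewrite size_drop; clear - al; lia.
have lq : last v (take l q) = nth x0 p (a + l).
  case: l {ls nE jZ2 gi good2 hL2 pp2 lp2} al sq => [|l] al sq.
    by rewrite take0 addn0.
  rewrite (last_nth x0) size_take_min (minn_idPl sq) /= nth_take // nth_drop.
  by congr nth; clear; lia.
have pq : path e v (take l q).
  apply: take_path; have : sorted (crossing e Z0 Z1) (v :: q).
    by rewrite -dropE; apply: drop_sorted.
  by apply: sub_path => x y /andP[].
have uq : uniq (v :: take l q).
  have : uniq (v :: q) by rewrite -dropE drop_uniq.
  by rewrite /= => /andP[vq uq]; rewrite take_uniq // andbT; apply: contra vq => /mem_take.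
have subq : {subset v :: take l q <= Z0 :|: Z1}.
  move=> z zq; apply: subp; apply: (@mem_drop a); rewrite dropE.
  by move: zq; rewrite !inE => /orP[->//|/mem_take ->]; rewrite orbT.
have dis (C C' : {set T}) (r r' : seq T) : [disjoint C & C'] ->
    {subset r <= C} -> {subset r' <= C'} -> ~~ has (mem r) r'.
  move=> dC sr sr'; apply/hasPn => z /sr' zC'; apply/negP => /sr zC.
  by rewrite (disjointFr dC zC) in zC'.
(* There are [l + 1] vertices on the path and [up_log 2 s + 1] on each branch. *)
exists (v :: take l q ++ p2 ++ rev p1); split.
- rewrite /= !size_cat size_rev size_take_min (minn_idPl sq) sp1 sp2 nE; clear; lia.
- rewrite -cat_cons !cat_uniq uq up2 rev_uniq up1 has_cat negb_or !has_rev.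
  rewrite (dis _ _ _ _ dZ1 subq sub1) (dis _ _ _ _ dZ2 subq sub2) /= andbT.
  by rewrite (dis _ _ _ _ _ sub2 sub1) // disjoint_sym.
rewrite /= rcons_cat cat_path pq lq rcons_cat cat_path pp2 lp2 /=.
case/lastP: p1 pp1 lp1 sp1 {up1 sub1} => [//|p1 y] pp1.
rewrite last_rcons rev_rcons => yE _; subst y.
rewrite rcons_cons /= se e12 /=.
have := rev_path e v (rcons p1 x1).
rewrite last_rcons belast_rcons rev_cons => ->.
by rewrite (eq_path (e' := e)).
Qed.

(** * A cycle or a gap in one colour *)

Definition has_cycle (T : finType) (e : rel T) (n : nat) : Prop :=
  exists p : seq T, [/\ size p = n, uniq p & cycle e p].

Lemma split_set (T : finType) (A : {set T}) (a b : nat) : a + b <= #|A| ->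
  exists B C : {set T},
    [/\ B \subset A, C \subset A, [disjoint B & C], #|B| = a & #|C| = b].
Proof.
move=> h; have [|B [sB cB]] := @subset_of_card _ A a; first lia.
have [|C [sC cC]] := @subset_of_card _ (A :\: B) b.
  by rewrite cardsD (setIidPr sB); lia.
exists B, C; split=> //; first exact: subset_trans sC (subsetDl _ _).
by move: sC; rewrite subsetD disjoint_sym => /andP[].
Qed.

Lemma disjointUU (T : finType) (A B C D : {set T}) :
  [disjoint A & C] -> [disjoint A & D] -> [disjoint B & C] -> [disjoint B & D] ->
  [disjoint A :|: B & C :|: D].
Proof.
rewrite -!setI_eq0 => /eqP h1 /eqP h2 /eqP h3 /eqP h4.
by rewrite setIUl !setIUr h1 h2 h3 h4 !setU0.
Qed.

(** For even [n] the stretch has odd length, so its ends lie in [Z0] and [Z1]. With [Z0], [Y1], [X2]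
    in [A] and [Z1], [X1], [Y2] in [B], every pair that must be joined goes across; three blocks of
    [10 * s] per side give [30 * s]. *)
Lemma even_cycle_or_gap (T : finType) (e : rel T) (s n : nat) (A B : {set T}) :
  symmetric e -> 0 < s -> 2 * up_log 2 s + 3 <= n <= s -> ~~ odd n ->
  [disjoint A & B] -> 30 * s <= #|A| -> 30 * s <= #|B| ->
  has_cycle e n \/
  exists A' B' : {set T},
    [/\ A' \subset A, B' \subset B, #|A'| = s, #|B'| = s & gap e A' B'].
Proof.
move=> se s_gt0 /andP[n1 n2] evn dAB cA cB.
have [j|/not_joined] := boolP (joined e s A B); [left | by right].
have jC := joinedC se j.
have [|Z0 [A1 [sZ0 sA1 dA1 cZ0 cA1]]] := @split_set _ A (10 * s) (20 * s); first by clear - cA; lia.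
have [|Y1 [X2 [sY1 sX2 dYX cY1 cX2]]] := @split_set _ A1 (10 * s) (10 * s); first by clear - cA1; lia.
have [|Z1 [B1 [sZ1 sB1 dB1 cZ1 cB1]]] := @split_set _ B (10 * s) (20 * s); first by clear - cB; lia.
have [|X1 [Y2 [sX1 sY2 dXY cX1 cY2]]] := @split_set _ B1 (10 * s) (10 * s); first by clear - cB1; lia.
have sY1A := subset_trans sY1 sA1; have sX2A := subset_trans sX2 sA1.
have sX1B := subset_trans sX1 sB1; have sY2B := subset_trans sY2 sB1.
have oddl : odd (n - (2 * up_log 2 s + 3)).
  by rewrite oddB // (negbTE evn) oddD oddM.
have dBA : [disjoint B & A] by rewrite disjoint_sym.
apply: (@joined_cycle T e s n (n - (2 * up_log 2 s + 3)) Z0 Z1 X1 Y1 X2 Y2) => //;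
  rewrite ?oddl ?cZ0 ?cZ1 ?cX1 ?cY1 ?cX2 ?cY2 //.
- exact: leq_trans (leq_subr _ _) n2.
- by clear - n1; lia.
- exact: joined_sub j.
- exact: joined_sub jC.
- exact: joined_sub j.
- exact: joined_sub j.
- exact: joined_sub jC.
- exact: joined_sub jC.
- exact: joined_sub j.
- exact: disjointW dAB.
- apply: disjointUU; first exact: disjointW dAB.
  + exact: disjointW dA1.
  + exact: disjointW dB1.
  + exact: disjointW dBA.
- apply: disjointUU; first exact: disjointW dA1.
  + exact: disjointW dAB.
  + exact: disjointW dBA.
  + exact: disjointW dB1.
- apply: disjointUU => //; first exact: disjointW dBA.
  exact: disjointW dAB.
Qed.

(** For odd [n] the stretch has even length and both ends in [Z0]. Now [Z0], [X1], [X2] must be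
    pairwise joined, which takes three sets; two blocks of [10 * s] in each suffice. *)
Lemma odd_cycle_or_gap (T : finType) (e : rel T) (s n : nat) (A B C : {set T}) :
  symmetric e -> 0 < s -> 2 * up_log 2 s + 3 <= n <= s -> odd n ->
  [disjoint A & B] -> [disjoint A & C] -> [disjoint B & C] ->
  20 * s <= #|A| -> 20 * s <= #|B| -> 20 * s <= #|C| ->
  has_cycle e n \/
  exists A' B' : {set T}, [/\ #|A'| = s, #|B'| = s, gap e A' B' &
    [\/ A' \subset A /\ B' \subset B, A' \subset A /\ B' \subset C
      | A' \subset B /\ B' \subset C]].
Proof.
move=> se s_gt0 /andP[n1 n2] on dAB dAC dBC cA cB cC.
have [jAB|/not_joined[A' [B' [h1 h2 h3 h4 h5]]]] := boolP (joined e s A B); last first.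
  by right; exists A', B'; split=> //; constructor 1.
have [jAC|/not_joined[A' [B' [h1 h2 h3 h4 h5]]]] := boolP (joined e s A C); last first.
  by right; exists A', B'; split=> //; constructor 2.
have [jBC|/not_joined[A' [B' [h1 h2 h3 h4 h5]]]] := boolP (joined e s B C); last first.
  by right; exists A', B'; split=> //; constructor 3.
left.
have [|Z0 [Y1 [sZ0 sY1 dA cZ0 cY1]]] := @split_set _ A (10 * s) (10 * s); first by clear - cA; lia.
have [|X1 [Y2 [sX1 sY2 dB cX1 cY2]]] := @split_set _ B (10 * s) (10 * s); first by clear - cB; lia.
have [|Z1 [X2 [sZ1 sX2 dC cZ1 cX2]]] := @split_set _ C (10 * s) (10 * s); first by clear - cC; lia.
have evl : odd (n - (2 * up_log 2 s + 3)) = false.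
  by rewrite oddB // on oddD oddM.
have dBA : [disjoint B & A] by rewrite disjoint_sym.
have dCA : [disjoint C & A] by rewrite disjoint_sym.
have dCB : [disjoint C & B] by rewrite disjoint_sym.
apply: (@joined_cycle T e s n (n - (2 * up_log 2 s + 3)) Z0 Z1 X1 Y1 X2 Y2) => //;
  rewrite ?evl ?cZ0 ?cZ1 ?cX1 ?cY1 ?cX2 ?cY2 //.
- exact: leq_trans (leq_subr _ _) n2.
- by clear - n1; lia.
- exact: joined_sub jAC.
- exact: joined_sub (joinedC se jAB).
- exact: joined_sub (joinedC se jBC).
- exact: joined_sub jAB.
- exact: joined_sub jAC.
- exact: joined_sub jBC.
- exact: joined_sub jAB.
- exact: disjointW dAC.
- apply: disjointUU => //; first exact: disjointW dAB.
  + exact: disjointW dCB.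
  + exact: disjointW dCA.
- apply: disjointUU => //; first exact: disjointW dAC.
  + exact: disjointW dAB.
  + exact: disjointW dCB.
- apply: disjointUU => //; first exact: disjointW dBC.
  + exact: disjointW dAC.
  + exact: disjointW dAB.
Qed.

(** * Removing the colours one after another *)

(** Turns the lower bound on cycle lengths in terms of [log N] into one in terms of [s], when sets
    of size at least [2 * s] live on at most [2 ^ d] vertices. *)
Lemma double_up_log (s d : nat) : 0 < s -> 2 * s <= 2 ^ d ->
  2 * up_log 2 s + 3 <= 2 * d + 2.
Proof.
case: d => [|d] s_gt0 h; first by clear - s_gt0 h; lia.
have : up_log 2 s <= d by rewrite up_log_min //; move: h; rewrite expnS leq_pmul2l.
by clear; lia.
Qed.

(* [odd_factor k * s] vertices suffice to remove [k] odd colours between two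
   sets of size [s].  One colour needs three sets of size [20 * s]; a further
   colour takes the factor [f] to [20 * f ^ 2]. *)
Definition odd_factor (k : nat) : nat :=
  if k is k'.+1 then 60 * 1200 ^ (2 ^ k' - 1) else 2.

(** As [20 * 60 = 1200], the number [20 * odd_factor k.+1] is [1200 ^ (2 ^ k)], which is squared at
    each step. *)
Lemma odd_factorSS k : odd_factor k.+2 = 20 * odd_factor k.+1 * odd_factor k.+1.
Proof.
rewrite /odd_factor.
have -> : 2 ^ k.+1 - 1 = (2 ^ k - 1) + (2 ^ k - 1) + 1.
  by have := expn_gt0 2 k; rewrite expnS; move: (2 ^ k) => w; lia.
by rewrite !expnD expn1; move: (1200 ^ _) => w; lia.
Qed.

Lemma odd_factor_ge2 k : 2 <= odd_factor k.
Proof.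
case: k => //= k; rewrite (@leq_trans 60) // -{1}[60]muln1 leq_pmul2l //.
by rewrite expn_gt0.
Qed.

Lemma odd_colors (T : finType) (I : eqType) (E : I -> rel T) (n : I -> nat)
    (m d : nat) (l : seq I) :
  (forall i, symmetric (E i)) -> #|T| <= 2 ^ d -> 0 < m ->
  {in l, forall i, odd (n i) /\ 2 * d + 2 <= n i <= m} ->
  forall (s : nat) (V : {set T}), m <= s -> odd_factor (size l) * s <= #|V| ->
  (exists i, has_cycle (E i) (n i)) \/
  exists A B : {set T}, [/\ A \subset V, B \subset V, [disjoint A & B], #|A| = s /\ #|B| = s
    & {in l, forall i, gap (E i) A B}].
Proof.
move=> sE cT m_gt0; elim: l => [|i l IHl] hl s V ms cV.
  right; have [|A [B [sA sB dAB cA cB]]] := @split_set _ V s s; last by exists A, B.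
  by move: cV => /=; clear; lia.
have [ni_odd /andP[ni1 ni2]] := hl i (mem_head _ _).
have {}hl : {in l, forall i, odd (n i) /\ 2 * d + 2 <= n i <= m}.
  by move=> j jl; apply: hl; rewrite inE jl orbT.
have {}IHl := IHl hl.
have s_gt0 : 0 < s by apply: leq_trans ms.
(* Three sets free of the colours in [l] suffice: unless its cycle exists, colour [i] is then
   removed between two of them. *)
suff [|[W0 [W1 [W2 [[s0 s1 s2] [c0 c1 c2] [d01 d02 d12] g01 [g02 g12]]]]]] :
    (exists i, has_cycle (E i) (n i)) \/ exists W0 W1 W2 : {set T},
    [/\ [/\ W0 \subset V, W1 \subset V & W2 \subset V],
        [/\ #|W0| = 20 * s, #|W1| = 20 * s & #|W2| = 20 * s],
        [/\ [disjoint W0 & W1], [disjoint W0 & W2] & [disjoint W1 & W2]],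
        {in l, forall j, gap (E j) W0 W1}
      & {in l, forall j, gap (E j) W0 W2} /\ {in l, forall j, gap (E j) W1 W2}].
- by left.
- have range : 2 * up_log 2 s + 3 <= n i <= s.
    rewrite (leq_trans ni2 ms) andbT (leq_trans _ ni1) //.
    apply: double_up_log => //; apply: leq_trans cT.
    by apply: leq_trans (max_card (mem W0)); rewrite c0 leq_pmul2r.
  have [|||?|[A [B [cA cB gAB hAB]]]] :=
    odd_cycle_or_gap (sE i) s_gt0 range ni_odd d01 d02 d12;
    rewrite ?c0 ?c1 ?c2 //; first by left; exists i.
  right; exists A, B.
  by case: hAB => -[sA sB]; split=> //; (try exact: subset_trans sA _);
    (try exact: subset_trans sB _); (try by apply: disjointW; eassumption);
    move=> j; rewrite inE => /predU1P[-> //|jl]; apply: gap_sub sA sB _; auto.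
case: l => [|j l] in hl IHl cV *.
  right; have [|W0 [W [s0 sW d0 c0 cW]]] := @split_set _ V (20 * s) (40 * s).
    by move: cV; rewrite /= /odd_factor expn0 subnn expn0; clear; lia.
  have [|W1 [W2 [s1 s2 d12 c1 c2]]] := @split_set _ W (20 * s) (20 * s).
    by clear - cW; lia.
  exists W0, W1, W2; split=> //; split=> //.
  - exact: subset_trans s1 sW.
  - exact: subset_trans s2 sW.
  - exact: disjointW d0.
  - exact: disjointW d0.
set F := odd_factor (size (j :: l)) in IHl.
have FE : odd_factor (size [:: i, j & l]) = 20 * F * F by apply: odd_factorSS.
have F_gt1 : 2 <= F := odd_factor_ge2 _.
(* The first round leaves [A] and [B] of size [F * (20 * s)], just enough for a second round inside
   [A]; a part of [B] serves as third set. *)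
have [||?|[A [B [sA sB dAB [cA cB] gAB]]]] := IHl (20 * F * s) V.
- by apply: leq_trans ms _; rewrite leq_pmull // muln_gt0 (leq_trans _ F_gt1).
- by rewrite (leq_trans _ cV) // FE; clear; lia.
- by left.
have [||?|[W0 [W1 [s0 s1 d01 [c0 c1] g01]]]] := IHl (20 * s) A.
- by apply: leq_trans ms _; rewrite leq_pmull.
- by rewrite cA; clear; lia.
- by left.
have [|W2 [s2 c2]] := @subset_of_card _ B (20 * s).
  by rewrite cB leq_pmul2r // leq_pmulr // (leq_trans _ F_gt1).
right; exists W0, W1, W2; split=> //; split=> //.
- exact: subset_trans sA.
- exact: subset_trans sA.
- exact: subset_trans sB.
- exact: disjointW dAB.
- exact: disjointW dAB.
- by move=> k kl; apply: gap_sub s0 s2 (gAB k kl).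
- by move=> k kl; apply: gap_sub s1 s2 (gAB k kl).
Qed.

(** Two sets suffice for an even colour, so each costs only a factor 30. The other colours are
    removed first, down to size [30 * s]; hence the induction is for all [s]. *)
Lemma even_colors (T : finType) (I : eqType) (E : I -> rel T) (n : I -> nat)
    (m d : nat) (l : seq I) :
  (forall i, symmetric (E i)) -> #|T| <= 2 ^ d -> 0 < m ->
  {in l, forall i, ~~ odd (n i) /\ 2 * d + 2 <= n i <= m} ->
  forall (s : nat) (A B : {set T}), m <= s -> [disjoint A & B] ->
  30 ^ size l * s <= #|A| -> 30 ^ size l * s <= #|B| ->
  (exists i, has_cycle (E i) (n i)) \/
  exists A' B' : {set T}, [/\ A' \subset A, B' \subset B, #|A'| = s, #|B'| = s
    & {in l, forall i, gap (E i) A' B'}].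
Proof.
move=> sE cT m_gt0; elim: l => [|i l IHl] hl s A B ms dAB cA cB.
  rewrite /= expn0 mul1n in cA cB; right.
  have [A' [sA cA']] := subset_of_card cA; have [B' [sB cB']] := subset_of_card cB.
  by exists A', B'.
have [ni_ev /andP[ni1 ni2]] := hl i (mem_head _ _).
have {}hl : {in l, forall i, ~~ odd (n i) /\ 2 * d + 2 <= n i <= m}.
  by move=> j jl; apply: hl; rewrite inE jl orbT.
rewrite /= expnSr -mulnA in cA cB.
have s_gt0 : 0 < s by apply: leq_trans ms.
have [|?|[A1 [B1 [sA sB cA1 cB1 gl]]]] := IHl hl (30 * s) A B _ dAB cA cB.
- by rewrite (leq_trans ms) // leq_pmull.
- by left.
have range : 2 * up_log 2 s + 3 <= n i <= s.
  rewrite (leq_trans ni2 ms) andbT (leq_trans _ ni1) //.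
  apply: double_up_log => //; apply: leq_trans cT.
  by apply: leq_trans (max_card (mem A1)); rewrite cA1 leq_pmul2r.
have [||?|[A2 [B2 [sA2 sB2 cA2 cB2 gi]]]] :=
  even_cycle_or_gap (sE i) s_gt0 range ni_ev (disjointW sA sB dAB);
  rewrite ?cA1 ?cB1 //; first by left; exists i.
right; exists A2, B2; split=> //; [exact: subset_trans sA | exact: subset_trans sB |].
by move=> j; rewrite inE => /predU1P[-> //|jl]; apply: gap_sub sA2 sB2 (gl j jl).
Qed.

(** * From cycles and gaps to the Ramsey bound *)

Lemma has_cycle_fun (T : finType) (e : rel T) (k : nat) : 0 < k -> has_cycle e k ->
  exists f : 'I_k -> T, injective f /\ forall j, e (f j) (f (ordS j)).
Proof.
move=> k_gt0 [[|x q] [/= sp up cp]]; first by rewrite -sp in k_gt0.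
subst k; exists (fun j => nth x (x :: q) j); split.
  by move=> i j /eqP; rewrite nth_uniq // => /eqP ij; apply: val_inj.
move=> j; have := (pathP x cp) j; rewrite size_rcons ltn_ord => /(_ isT).
rewrite -rcons_cons nth_rcons [size _]/= ltn_ord /= nth_rcons.
have [lt|ge] := ltnP j (size q); first by rewrite modn_small.
(* At the last index [ordS] wraps to 0, and [rcons] supplies the first vertex [x]. *)
have jE : nat_of_ord j = size q by apply/eqP; rewrite eqn_leq ge andbT -ltnS.
by rewrite jE eqxx modnn.
Qed.

Require Import Defs.
From HB Require Import structures.
From mathcomp Require Import all_boot all_order all_algebra.
From mathcomp Require Import all_classical all_reals all_analysis.
From mathcomp Require Import lra.
Import Order.TTheory GRing.Theory Num.Theory.

(** Factor by factor: [60 <= 82], [1200 <= 35 ^ 2] and [30 <= 81]; without odd colours the exponent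
    is -1 and [2 <= 82 / 35]. *)
Lemma le_boundN (R : realType) (t : nat) (n : 'I_t -> nat) (m : nat) :
  ((odd_factor (t_odd n) * 30 ^ t_even n * m)%N%:R <= boundN R n m)%R.
Proof.
rewrite /boundN !natrM; apply: ler_wpM2r; first exact: ler0n.
apply: ler_pM; rewrite ?ler0n //; last first.
  by rewrite natrX; apply: lerXn2r; rewrite ?nnegrE ?ler0n // ler_nat.
case: (t_odd n) => [|k] /=.
  have -> : ((2 ^ 0)%N%:Z - 2 = -1)%R by [].
  rewrite exprN1; lra.
have -> : ((2 ^ k.+1)%N%:Z - 2 = (2 * (2 ^ k - 1))%N%:Z)%R.
  have := expn_gt0 2 k; rewrite expnS; move: (2 ^ k) => w; lia.
rewrite -exprnP exprM natrM natrX; apply: ler_pM; rewrite ?exprn_ge0 ?ler0n ?ler_nat //.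
by apply: lerXn2r; rewrite ?nnegrE; lra.
Qed.

Lemma boundN_log (R : realType) (t : nat) (n : 'I_t -> nat) (m : nat) :
  (0 < m)%N ->
  exists d : nat, (boundN R n m <= 2 ^+ d)%R /\ (Num.ceil (log2 (boundN R n m)) = d%:Z)%R.
Proof.
move=> m_gt0.
have N2 : (2 <= boundN R n m)%R.
  apply: le_trans (le_boundN R n m); rewrite ler_nat.
  rewrite -[2]muln1 -[1]muln1 mulnA !leq_mul ?odd_factor_ge2 ?expn_gt0 //.
have ln2_gt0 : (0 < ln (2 : R))%R by rewrite ln_gt0 // ltr1n.
have log_ge0 : (0 <= log2 (boundN R n m))%R.
  by rewrite /log2 divr_ge0 ?ltW // ln_gt0 // (lt_le_trans _ N2) // ltr1n.
have c_ge0 : (0 <= Num.ceil (log2 (boundN R n m)))%R.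
  by rewrite -(ler_int R) (le_trans log_ge0) // Num.Theory.ceil_ge.
exists `|Num.ceil (log2 (boundN R n m))|%N; split; last by rewrite gez0_abs.
have N_gt0 : (0 < boundN R n m)%R by apply: lt_le_trans N2; rewrite ltr0n.
rewrite -ler_ln ?posrE ?exprn_gt0 // lnXn // -[(ln 2 *+ _)%R]mulr_natl.
rewrite -ler_pdivrMr // -/(log2 _) natr_absz ger0_norm //.
exact: Num.Theory.ceil_ge.
Qed.

Theorem theorem2p12 (R : realType) (t : nat) (n : 'I_t -> nat) (m : nat) :
  (forall i, 0 < n i)%N -> (0 < m)%N ->
  (forall i, (n i <= m)%N /\
     (2 * ((Num.ceil (log2 (boundN R n m)))%:~R + 1) <= (n i)%:R :> R)%R) ->
  ramsey_le n m (boundN R n m).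
Proof.
move=> n_gt0 m_gt0 hn.
have [d [hd dE]] := boundN_log R n m_gt0.
set N := (odd_factor (t_odd n) * 30 ^ t_even n * m)%N.
exists N; split; first exact: le_boundN.
move=> c sc.
have nd i : (2 * d + 2 <= n i <= m)%N.
  have [-> +] := hn i; rewrite dE andbT -(ler_nat R) natrD natrM => h; apply: le_trans h.
  by rewrite mulrDr mulr1 -pmulrn.
have cT : (#|'I_N| <= 2 ^ d)%N.
  by rewrite card_ord -(ler_nat R) natrX (le_trans (le_boundN R n m)).
pose E (i : 'I_t) : rel 'I_N := fun x y => c x y == Some i.
have sE i : symmetric (E i) by move=> x y; rewrite /E sc.
have mono : (exists i, has_cycle (E i) (n i)) ->
    exists i : 'I_t, has_mono_cycle c (n i) (Some i).
  move=> [i /(has_cycle_fun (n_gt0 i))[f [injf hf]]].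
  by exists i, f; split=> // j; apply/eqP/hf.
(* The odd stage must leave sets of this size for the even stage to end at size [m]. *)
set s := (30 ^ t_even n * m)%N.
have ms : (m <= s)%N by rewrite leq_pmull // expn_gt0.
have [||/mono ?|[A [B [_ _ dAB [cA cB] gAB]]]] :=
  @odd_colors _ _ E n m d (enum [set i | odd (n i)]) sE cT m_gt0 _ s [set: 'I_N] ms.
- by move=> i; rewrite mem_enum inE.
- by rewrite -cardE cardsT card_ord mulnA.
- by left.
have [|||/mono ?|[A' [B' [sA sB cA' cB' gAB']]]] :=
  @even_colors _ _ E n m d (enum [set i | ~~ odd (n i)]) sE cT m_gt0 _ m A B (leqnn m) dAB.
- by move=> i; rewrite mem_enum inE.
- by rewrite -cardE cA.
- by rewrite -cardE cB.
- by left.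
right.
exists (fun a => enum_val (cast_ord (esym cA') a)).
exists (fun b => enum_val (cast_ord (esym cB') b)).
split; first by move=> a b /enum_val_inj/cast_ord_inj.
split; first by move=> a b /enum_val_inj/cast_ord_inj.
split=> a b.
  have xA := fintype.subsetP sA _ (enum_valP (cast_ord (esym cA') a)).
  move=> xy; rewrite xy in xA.
  have yB := fintype.subsetP sB _ (enum_valP (cast_ord (esym cB') b)).
  by rewrite (disjointFr dAB xA) in yB.
have xA := enum_valP (cast_ord (esym cA') a).
have yB := enum_valP (cast_ord (esym cB') b).
set x := enum_val _ in xA *; set y := enum_val _ in yB *.
(* An odd colour on this edge is excluded by the gap between [A] and [B], an even one by that
   between [A'] and [B']. *)
case cxy : (c x y) => [i|] //; exfalso.
have [oi|ei] := boolP (odd (n i)).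
  have /gapP g : gap (E i) A B by apply: gAB; rewrite mem_enum inE.
  by have := g x y (fintype.subsetP sA x xA) (fintype.subsetP sB y yB); rewrite /E cxy eqxx.
have /gapP g : gap (E i) A' B' by apply: gAB'; rewrite mem_enum inE.
by have := g x y xA yB; rewrite /E cxy eqxx.
Qed.
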